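(* For every integer $n\ge 1$, the number of distinct (nonempty) palindromes occurring as factors of $\mathbb{F}[1,n]$, the prefix of length $n$ of the Fibonacci sequence, is exactly $n$.
   Context: The Fibonacci sequence $\mathbb{F}=abaababaabaab\cdots$ is the infinite word over $\{a,b\}$ that begins with $a$ and is fixed by the morphism $\sigma$ defined by $\sigma(a)=ab$, $\sigma(b)=a$. Letters are indexed from $1$, and $\mathbb{F}[i,j]$ denotes the factor of $\mathbb{F}$ from its $i$-th to its $j$-th letter. A palindrome is a finite word equal to its reversal. The empty word is not counted as a palindrome. *)

(* Defs.v *)
From HB Require Import structures.
From mathcomp Require Import all_boot.

Set Implicit Arguments.
Unset Strict Implicit.
Unset Printing Implicit Defensive.

Inductive letter : Type := a | b.

Definition letter_to_bool (x : letter) : bool := if x is a then true else false.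
Definition bool_to_letter (x : bool) : letter := if x then a else b.

Lemma letter_to_boolK : cancel letter_to_bool bool_to_letter.
Proof. by case. Qed.

HB.instance Definition _ := Equality.copy letter (can_type letter_to_boolK).

Definition word := seq letter.

(* [u i] is the letter of the infinite word u in position i.+1: positions are
   counted from 1 in [factor] below, as in F[i,j]. *)
Definition infinite_word := nat -> letter.

Definition factor (u : infinite_word) (i j : nat) : word :=
  [seq u k.-1 | k <- iota i (j.+1 - i)].

Definition sigma_letter (x : letter) : word :=
  match x with a => [:: a; b] | b => [:: a] end.

Definition sigma (w : word) : word := flatten [seq sigma_letter x | x <- w].

(* sigma erases no letter, so the image of the prefix of length i.+1 has length
   at least i.+1 and already contains the letter of index i of the image of u:
   the default value of [nth] is never used. *)
Definition sigma_inf (u : infinite_word) : infinite_word :=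
  fun i => nth a (sigma (mkseq u i.+1)) i.

Definition is_fibonacci (F : infinite_word) : Prop :=
  F 0 = a /\ sigma_inf F =1 F.

Definition palindrome (w : word) : bool := (w != [::]) && (rev w == w).

Definition factors (w : word) : seq word :=
  undup [seq take l (drop i w) | i <- iota 0 (size w).+1, l <- iota 0 (size w).+1].

Definition palindromes (w : word) : seq word :=
  [seq p <- factors w | palindrome p].

Lemma mem_factors (p w : word) : (p \in factors w) = infix p w.
Proof.
rewrite mem_undup; apply/allpairsP/infixP => [[[i l] [/= _ _ ->]]|[s1 [s2 ->]]].
  by exists (take i w), (drop l (drop i w)); rewrite cat_take_drop cat_take_drop.
exists (size s1, size p); split; rewrite ?[_.1]/= ?[_.2]/=.
- by rewrite mem_iota add0n ltnS !size_cat leq_addr.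
- by rewrite mem_iota add0n ltnS !size_cat addnCA leq_addr.
- by rewrite drop_size_cat // take_size_cat.
Qed.

Lemma palindromes_uniq (w : word) : uniq (palindromes w).
Proof. exact: filter_uniq (undup_uniq _). Qed.

Lemma mem_palindromes (p w : word) :
  (p \in palindromes w) = palindrome p && infix p w.
Proof. by rewrite mem_filter mem_factors. Qed.

Lemma sigma_cat (v w : word) : sigma (v ++ w) = sigma v ++ sigma w.
Proof. by rewrite /sigma map_cat flatten_cat. Qed.

Lemma size_sigma (w : word) : size w <= size (sigma w).
Proof.
by elim: w => //= x w IH; rewrite [sigma _]/= size_cat -add1n leq_add //; case: x.
Qed.

Lemma size_sigma_a (w : word) : (size w).+1 < size (sigma (a :: w)).
Proof. exact: leq_add (leqnn 2) (size_sigma w). Qed.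

Definition sigma_iter (n : nat) : word := iter n sigma [:: a].

Lemma sigma_iter_prefix n : prefix (sigma_iter n) (sigma_iter n.+1).
Proof.
elim: n => // n /prefixP[s IH].
change (prefix (sigma (sigma_iter n)) (sigma (sigma_iter n.+1))).
by rewrite IH sigma_cat prefix_prefix.
Qed.

Lemma sigma_iter_prefixW m n : m <= n -> prefix (sigma_iter m) (sigma_iter n).
Proof.
elim: n => [|n IH]; first by rewrite leqn0 => /eqP->.
rewrite leq_eqVlt => /predU1P[->|/IH]; first exact: prefix_refl.
by move/prefix_trans; apply; apply: sigma_iter_prefix.
Qed.

Lemma size_sigma_iter n : n < size (sigma_iter n).
Proof.
elim: n => // n IH.
have /prefixP[s E] := sigma_iter_prefixW (leq0n n).
move: IH; rewrite [sigma_iter n.+1]/(sigma (sigma_iter n)) E.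
by move=> lt_n; apply: leq_ltn_trans lt_n (size_sigma_a s).
Qed.

Lemma nth_prefix (v w : word) i : prefix v w -> i < size v -> nth a w i = nth a v i.
Proof. by move=> /prefixP[s ->] lt_i; rewrite nth_cat lt_i. Qed.

Lemma is_fibonacci_exists : exists F, is_fibonacci F.
Proof.
pose F i := nth a (sigma_iter i) i.
have FE n i : i < size (sigma_iter n) -> F i = nth a (sigma_iter n) i.
  move=> lt_i; have [le|/ltnW le] := leqP i n.
    by rewrite (nth_prefix (sigma_iter_prefixW le) (size_sigma_iter i)).
  by rewrite /F (nth_prefix (sigma_iter_prefixW le) lt_i).
exists F; split => // i.
have E : mkseq F i.+1 = take i.+1 (sigma_iter i).
  apply: (@eq_from_nth _ a).
    by rewrite size_mkseq size_takel // size_sigma_iter.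
  move=> j; rewrite size_mkseq => lt_j.
  rewrite nth_mkseq // nth_take // (FE i) //.
  exact: leq_trans lt_j (size_sigma_iter i).
have P : prefix (sigma (mkseq F i.+1)) (sigma_iter i.+1).
  have -> : sigma_iter i.+1 = sigma (take i.+1 (sigma_iter i)) ++
      sigma (drop i.+1 (sigma_iter i)) by rewrite -sigma_cat cat_take_drop.
  by rewrite E prefix_prefix.
have lt_i : i < size (sigma (mkseq F i.+1)).
  by apply: leq_trans (size_sigma _); rewrite size_mkseq.
rewrite /sigma_inf -(nth_prefix P lt_i) -(FE i.+1) //.
exact: ltnW (size_sigma_iter i.+1).
Qed.

Lemma is_fibonacci_unique F G : is_fibonacci F -> is_fibonacci G -> F =1 G.
Proof.
move=> [F0 Ff] [G0 Gf].
suff H n i : i < n -> F i = G i by move=> i; apply: (H i.+1).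
elim: n i => // n IH i; rewrite ltnS leq_eqVlt => /predU1P[->|]; last exact: IH.
case: n IH => [_|n IH]; first by rewrite F0 G0.
have E : mkseq F n.+1 = mkseq G n.+1.
  by apply/eq_in_map => j; rewrite mem_iota => /IH.
have S (H : infinite_word) : H 0 = a -> nth a (sigma (mkseq H n.+2)) n.+1 =
   nth a (sigma (mkseq H n.+1)) n.+1.
  move=> H0; rewrite [mkseq H n.+2]mkseqS -cats1 sigma_cat nth_cat ifT //.
  rewrite /mkseq /= H0.
  by apply: leq_ltn_trans (size_sigma_a _); rewrite size_map size_iota.
by rewrite -Ff -Gf /sigma_inf !S // E.
Qed.

(* Main.v *)
Require Import Defs.
From mathcomp Require Import all_boot.

(** A word of length [n] has at most [n] distinct palindromes, and words
    attaining this bound pass the property on to their prefixes: appending one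
    letter creates at most one new palindrome, because a shorter palindromic
    suffix of a palindrome is also a prefix of it, hence occurred before
    ([size_palindromes_cat]).  It therefore suffices to find arbitrarily long
    prefixes of F that have at least as many palindromes as letters.

    These prefixes are the central words [v_0] empty, [v_(k+1) = sigma v_k . a];
    they are prefixes of F because F is fixed by [sigma] and every block of
    [sigma] begins with [a] ([fibonacci_central_step]).
    If [q] is a palindrome or empty, then [sigma q . a] is a palindrome.  If [q]
    begins with [a], this palindrome has the form [a . p . a] where [p] begins
    with [b] and is a palindrome too.  Hence each palindrome [q] of [v], and
    also the empty word, yields a palindrome of [sigma v . a] beginning with
    [a], and each [q] beginning with [a] yields one, [p], beginning with [b].
    On the other side, [sigma v . a] has [|v| + 1] letters [a], and as many
    letters [b] as [v] has letters [a].  So the refined inequality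
    -- for each letter [x], at least as many palindromes begin with [x] as there
    are occurrences of [x] -- passes from [v] to [sigma v . a]
    ([abundant_central_step]).  Since [sigma] is injective ([sigma_inj]), the
    palindromes obtained are distinct, and the general upper bound turns these
    inequalities into equalities. *)

(** The longer of two palindromic suffixes begins with the shorter one, so at
    most one palindrome is completed by the last letter. *)
Lemma new_palindrome_unique (w : word) (x : letter) (p q : word) :
  p \in palindromes (rcons w x) -> ~~ infix p w ->
  q \in palindromes (rcons w x) -> ~~ infix q w -> p = q.
Proof.
wlog le_pq : p q / size p <= size q => [hw|].
  by case/orP: (leq_total (size p) (size q)) => le *; [|symmetry]; apply: hw.
rewrite !mem_palindromes !infix_rconsl => /andP[/andP[_ /eqP rp] op] np.
move=> /andP[/andP[_ /eqP rq] oq] nq.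
rewrite (negbTE np) (negbTE nq) !orbF in op oq.
have sub_pq : suffix p q.
  move: op oq; rewrite !suffixE => /eqP op /eqP oq.
  have le_q : size q <= size (rcons w x) by rewrite -oq size_drop leq_subr.
  have def_drop : drop (size q - size p) q = p.
    by rewrite -[X in drop _ X]oq drop_drop addnC addnBA // subnK.
  by rewrite def_drop.
rewrite -prefix_rev rp rq in sub_pq.
case/prefixP: sub_pq => t def_q.
case/lastP: t def_q => [|t y] def_q; first by rewrite def_q cats0.
case/suffixP: oq => s; rewrite def_q -rcons_cat -rcons_cat => /rcons_inj[def_w _].
by case/negP: np; rewrite def_w infix_infix.
Qed.

Lemma size_palindromes_rcons (w : word) (x : letter) :
  size (palindromes (rcons w x)) <= (size (palindromes w)).+1.
Proof.
rewrite -(count_predC (fun p => infix p w)) -addn1 leq_add //.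
  rewrite -size_filter; apply: uniq_leq_size.
    exact: filter_uniq (palindromes_uniq _).
  by move=> p; rewrite mem_filter !mem_palindromes => /and3P[-> -> _].
rewrite -size_filter.
set r := filter _ _.
have: uniq r by apply: filter_uniq; apply: palindromes_uniq.
have: forall p q, p \in r -> q \in r -> p = q.
  move=> p q; rewrite /r 2!(mem_filter (predC _)) => /andP[np hp] /andP[nq hq].
  exact: (new_palindrome_unique w x p q hp np hq nq).
case: r => [|p [|q r]] // eq_r; rewrite /= inE (eq_r p q) ?eqxx //.
  exact: mem_head.
by rewrite !inE eqxx orbT.
Qed.

Lemma size_palindromes_cat (u s : word) :
  size (palindromes (u ++ s)) <= size (palindromes u) + size s.
Proof.
elim/last_ind: s => [|s x IH]; first by rewrite cats0 addn0.
rewrite -rcons_cat size_rcons addnS.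
by apply: leq_trans (size_palindromes_rcons _ _) _.
Qed.

Lemma size_palindromes_le (w : word) : size (palindromes w) <= size w.
Proof. exact: size_palindromes_cat [::] w. Qed.

(** Appending letters cannot decrease [size w - size (palindromes w)], so if
    this difference vanishes for a word, it does for all its prefixes. *)
Lemma full_prefix (u w : word) :
  prefix u w -> size w <= size (palindromes w) -> size (palindromes u) = size u.
Proof.
case/prefixP=> s -> full; apply/eqP; rewrite eqn_leq size_palindromes_le /=.
rewrite -(leq_add2r (size s)) -size_cat.
exact: leq_trans full (size_palindromes_cat _ _).
Qed.

(** Each block of [sigma] begins with [a], so whether a block [a] continues with
   [b] can be read off from the next letter. *)
Lemma sigma_inj : injective sigma.
Proof.
have sigmaNb w t : sigma w <> b :: t by case: w => // -[].
elim=> [|x v IH] [|y w] //; [by case: y | by case: x | case: x; case: y].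
- by case=> /IH->.
- by case=> /esym/sigmaNb.
- by case=> /sigmaNb.
- by case=> /IH->.
Qed.

(** The word [sigma w . a] splits both as blocks [ab], [a] closed by [a] and as
    [a] followed by blocks [ba], [a]; reversal exchanges these two readings. *)
Lemma rev_rcons_sigma (w : word) :
  rev (rcons (sigma w) a) = rcons (sigma (rev w)) a.
Proof.
elim: w => // x w IH; rewrite -[sigma (x :: w)]/(sigma_letter x ++ sigma w).
rewrite rcons_cat rev_cat IH rev_cons -(cats1 (rev w)) sigma_cat.
by case: x; rewrite rcons_cat cat_rcons.
Qed.

Lemma infix_sigma (v w : word) :
  infix v w -> infix (rcons (sigma v) a) (rcons (sigma w) a).
Proof.
case/infixP=> s [t ->]; rewrite !sigma_cat -!cats1 -!catA.
suff [r ->] : exists r, sigma t ++ [:: a] = a :: r.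
  by rewrite -(cat1s a r) (catA (sigma v)) infix_infix.
by case: t => [|[] t]; eexists.
Qed.

Lemma palindrome_rcons_sigma (q : word) :
  rev q = q -> palindrome (rcons (sigma q) a).
Proof.
move=> rq; rewrite /palindrome rev_rcons_sigma rq eqxx andbT.
by case: (sigma q).
Qed.

(** Here [b :: sigma t] is the word left of the palindrome [sigma (a :: t) . a]
    once the letters [a] at its two ends are removed. *)
Lemma palindrome_sigma_inner (t : word) :
  rev (a :: t) = a :: t -> palindrome (b :: sigma t).
Proof.
move/palindrome_rcons_sigma; rewrite -[sigma (a :: t)]/(a :: b :: sigma t).
rewrite /palindrome rev_rcons (rev_cons a) rcons_cons => /andP[_].
by rewrite eqseq_cons eqseq_rcons !eqxx andbT.
Qed.

Definition starts (x : letter) (w : word) : bool := ohead w == Some x.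

Definition abundant (w : word) : Prop :=
  forall x, count_mem x w <= count (starts x) (palindromes w).

Lemma count_letters (w : word) : count_mem a w + count_mem b w = size w.
Proof. by elim: w => // -[] w /= <-; rewrite ?addnS ?addSn. Qed.

Lemma abundant_full (w : word) :
  abundant w -> size w <= size (palindromes w).
Proof.
move=> ab; rewrite -count_letters; apply: leq_trans (leq_add (ab a) (ab b)) _.
have disjoint_starts : predI (starts a) (starts b) =1 pred0 by case=> [|[]].
rewrite -count_predUI (eq_count disjoint_starts) count_pred0 addn0.
exact: count_size.
Qed.

Lemma count_sigma (w : word) :
  count_mem a (sigma w) = size w /\ count_mem b (sigma w) = count_mem a w.
Proof.
by elim: w => // x w [IHa IHb]; split; case: x; rewrite /= ?IHa ?IHb.
Qed.

(** The palindromes of [sigma v . a] beginning with [a] come from all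
    palindromes of [v] and the empty word (which accounts for the final [a]),
    those beginning with [b] from the palindromes of [v] beginning with [a]. *)
Lemma abundant_central_step (v : word) :
  abundant v -> abundant (rcons (sigma v) a).
Proof.
move=> ab_v; have [cnt_a cnt_b] := count_sigma v.
case; rewrite -cats1 count_cat ?cnt_a ?cnt_b cats1 /= ?addn1 ?addn0.
  apply: leq_trans (_ : (size (palindromes v)).+1 <= _).
    exact: abundant_full.
  pose qs : seq (seq letter) := [::] :: palindromes v.
  rewrite -size_filter -[_.+1]/(size qs).
  rewrite -(size_map (fun q : seq letter => rcons (sigma q) a) qs).
  apply: uniq_leq_size.
    rewrite map_inj_uniq; last by move=> p q /rcons_inj[/sigma_inj].
    by rewrite /= palindromes_uniq mem_palindromes.
  move=> _ /mapP[q q_qs ->]; rewrite mem_filter mem_palindromes.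
  have [rq qv] : rev q = q /\ infix q v.
    move: q_qs; rewrite inE mem_palindromes => /predU1P[->|].
      by rewrite infix0s.
    by case/andP=> /andP[_ /eqP].
  rewrite palindrome_rcons_sigma // infix_sigma // !andbT.
  by case: (q) => [|[]].
apply: leq_trans (ab_v a) _; rewrite -!size_filter.
rewrite -(size_map (fun q : seq letter => behead (sigma q))).
have starts_aP q : starts a q -> q = a :: behead q by case: q => [|[]].
apply: uniq_leq_size.
  rewrite map_inj_in_uniq; first exact: filter_uniq (palindromes_uniq _).
  move=> p q; rewrite !mem_filter => /andP[/starts_aP-> _] /andP[/starts_aP-> _].
  by case=> /sigma_inj->.
move=> _ /mapP[q + ->]; rewrite 2!(mem_filter (starts _)) !mem_palindromes.
case/and3P=> /starts_aP -> /andP[_ /eqP rq] qv.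
rewrite palindrome_sigma_inner // [starts _ _]/=.
apply: infix_trans (infix_sigma _ _ qv).
by apply/infixP; exists [:: a], [:: a]; rewrite cats1.
Qed.

Lemma factorE (F : infinite_word) (n : nat) : factor F 1 n = mkseq F n.
Proof. by rewrite /factor subn1 (iotaDl 1 0) -map_comp. Qed.

Lemma prefix_mkseq (F : infinite_word) (m n : nat) :
  m <= n -> prefix (mkseq F m) (mkseq F n).
Proof.
move=> le_mn; rewrite /mkseq -(subnKC le_mn) iotaD map_cat.
exact: prefix_prefix.
Qed.

Lemma prefix_sigma (v w : word) : prefix v w -> prefix (sigma v) (sigma w).
Proof. by case/prefixP=> s ->; rewrite sigma_cat prefix_prefix. Qed.

(** The letter of index [i] of F is read in the image of the prefix of length
    [i + 1]; that image and [sigma (mkseq F m)] are comparable as prefixes, so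
    they agree at [i]. *)
Lemma fibonacci_sigma_prefix (F : infinite_word) (m : nat) :
  is_fibonacci F -> sigma (mkseq F m) = mkseq F (size (sigma (mkseq F m))).
Proof.
move=> [_ fix_F]; apply: (@eq_from_nth _ a); rewrite ?size_mkseq // => i lt_i.
rewrite nth_mkseq // -fix_F /sigma_inf.
have [le|/ltnW le] := leqP i.+1 m; have /prefix_sigma pre := prefix_mkseq F _ _ le.
  apply: nth_prefix pre _; apply: leq_trans (size_sigma _).
  by rewrite size_mkseq.
by symmetry; apply: nth_prefix pre _.
Qed.

(** The letter after the block prefix [sigma v] is the first letter of the next
    block, and every block begins with [a]. *)
Lemma fibonacci_central_step (F : infinite_word) (m : nat) :
  is_fibonacci F ->
  rcons (sigma (mkseq F m)) a = mkseq F (size (sigma (mkseq F m))).+1.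
Proof.
move=> fib_F; rewrite mkseqS -fibonacci_sigma_prefix //; congr rcons.
have := fibonacci_sigma_prefix F m.+1 fib_F.
rewrite mkseqS -[rcons _ (F m)]cats1 sigma_cat.
set s := sigma (mkseq F m); set t := sigma _ => def_st.
have lt_st : size s < size (s ++ t).
  by rewrite size_cat -addn1 leq_add2l /t; case: (F m).
have := nth_mkseq a F lt_st; rewrite -def_st nth_cat ltnn subnn => <-.
by rewrite /t; case: (F m).
Qed.

Lemma abundant_long_prefix (F : infinite_word) (n : nat) :
  is_fibonacci F -> exists2 m, n <= m & abundant (mkseq F m).
Proof.
move=> fib_F; elim: n => [|n [m le_nm ab_m]]; first by exists 0 => // x.
exists (size (sigma (mkseq F m))).+1.
  by rewrite ltnS; apply: leq_trans (size_sigma _); rewrite size_mkseq.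
by rewrite -fibonacci_central_step //; apply: abundant_central_step.
Qed.

Theorem theorem4p5 (F : infinite_word) (hF : is_fibonacci F) (n : nat) (hn : 1 <= n) :
  size (palindromes (factor F 1 n)) = n.
Proof.
have [m le_nm ab_m] := abundant_long_prefix F n hF.
rewrite factorE (full_prefix _ _ (prefix_mkseq F _ _ le_nm)) ?size_mkseq //.
by rewrite -[X in X <= _](size_mkseq F); apply: abundant_full.
Qed.
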